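(* Let $r$ be a positive integer with $r\le 2\lfloor k/2\rfloor\lfloor (n-k)/2\rfloor$. Then at every $Q\in\operatorname{Gr}(k,n)$, \[ \overline{\delta}_{2,r}=\frac{k(n-k)(n-2)}{8},\qquad \underline{\delta}_{2,r}=\frac{k(n-k)(n-2)}{8}-\frac r4. \]
   Context: Fix integers $1\le k\le n-1$. Let $\mathbb{S}^n$ be the space of real symmetric $n\times n$ matrices with inner product $\operatorname{tr}(X^{\mathsf T}Y)$. Define $\operatorname{Gr}(k,n)=\{Q\in\mathbb{S}^n: Q^2=I_n,\ \operatorname{tr}(Q)=2k-n\}$ with the induced Riemannian metric and Levi-Civita connection $\nabla$. Let $\mathrm{Rm}(X,Y,Z,W)=\langle\nabla_X\nabla_YZ-\nabla_Y\nabla_XZ-\nabla_{[X,Y]}Z,W\rangle$, sectional curvature $\kappa_Q(V)=\mathrm{Rm}_Q(X,Y,Y,X)$ for a 2-dimensional subspace $V\subseteq\mathbb{T}_Q\operatorname{Gr}(k,n)$ with orthonormal basis $X,Y$, $\mathrm{Ric}_Q(X,Y)=\sum_i\mathrm{Rm}_Q(X,E_i,E_i,Y)$ and $\mathrm{Scal}_Q=\sum_i\mathrm{Ric}_Q(E_i,E_i)$ for an orthonormal basis $(E_i)$ of $\mathbb{T}_Q$. Define $\overline{\delta}_{2,r}=\mathrm{Scal}_Q-\inf\sum_{j=1}^r\kappa_Q(V_j)$ and $\underline{\delta}_{2,r}=\mathrm{Scal}_Q-\sup\sum_{j=1}^r\kappa_Q(V_j)$, where the infimum/supremum range over all $r$-tuples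 of mutually orthogonal 2-dimensional subspaces $V_1,\dots,V_r\subseteq\mathbb{T}_Q\operatorname{Gr}(k,n)$. *)

(* Defs.v *)
From HB Require Import structures.
From mathcomp Require Import all_boot all_order all_algebra.
From mathcomp Require Import classical_sets reals topology normedtype derive.
Set Implicit Arguments. Unset Strict Implicit. Unset Printing Implicit Defensive.
Import Order.TTheory GRing.Theory Num.Theory.
Local Open Scope ring_scope.
Local Open Scope classical_set_scope.

Section Grassmannian.
Variable R : realType.
Variable n : nat.
Notation mx := 'M[R]_n.

Definition ip (X Y : mx) : R := \tr (X^T *m Y).

Definition inGr (k : nat) (Q : mx) : Prop :=
  Q^T = Q /\ Q *m Q = 1%:M /\ \tr Q = (2 * k)%:R - n%:R.

Definition tangent (Q X : mx) : Prop := X^T = X /\ Q *m X + X *m Q = 0.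

Definition dirD (f : mx -> mx) (A B : mx) : mx :=
  \matrix_(i, j) @derive1 R R^o (fun t : R => f (A + t *: B) i j) 0.

Definition symp (Z : mx) : mx := 2^-1 *: (Z + Z^T).

(* orthogonal projection of S^n onto T_A (for A in Gr(k,n)):
   Z |-> (Z - A Z A)/2, applied to the symmetric part *)
Definition tproj (A Z : mx) : mx := 2^-1 *: (symp Z - A *m symp Z *m A).

(* the tangent vector field A |-> tproj A x extending x in T_Q *)
Definition ext (x : mx) : mx -> mx := fun A => tproj A x.

(* induced (Levi-Civita) connection of the embedded submanifold:
   tangential projection of the ambient derivative *)
Definition nabla (U V : mx -> mx) : mx -> mx :=
  fun A => tproj A (dirD V A (U A)).

Definition lieb (U V : mx -> mx) : mx -> mx :=
  fun A => dirD V A (U A) - dirD U A (V A).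

Definition Rm (Q x y z w : mx) : R :=
  let X := ext x in let Y := ext y in let Z := ext z in
  ip (nabla X (nabla Y Z) Q - nabla Y (nabla X Z) Q - nabla (lieb X Y) Z Q) w.

(* sectional curvature of span(x,y), x,y orthonormal *)
Definition kappa (Q x y : mx) : R := Rm Q x y y x.

Definition is_onb (Q : mx) (d : nat) (E : 'I_d -> mx) : Prop :=
  (forall i, tangent Q (E i)) /\
  (forall i j, ip (E i) (E j) = (i == j)%:R) /\
  (forall X, tangent Q X -> X = \sum_i ip X (E i) *: E i).

Definition Ric (Q : mx) (d : nat) (E : 'I_d -> mx) (x y : mx) : R :=
  \sum_i Rm Q x (E i) (E i) y.
Definition Scal (Q : mx) (d : nat) (E : 'I_d -> mx) : R :=
  \sum_i Ric Q E (E i) (E i).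

(* r mutually orthogonal 2-planes V_j = span(X j, Y j) in T_Q, given by
   orthonormal bases (X j, Y j) such that all 2r vectors are orthonormal *)
Definition orth_planes (Q : mx) (r : nat) (X Y : 'I_r -> mx) : Prop :=
  (forall j, tangent Q (X j) /\ tangent Q (Y j)) /\
  (forall i j, ip (X i) (X j) = (i == j)%:R) /\
  (forall i j, ip (Y i) (Y j) = (i == j)%:R) /\
  (forall i j, ip (X i) (Y j) = 0).

Definition sect_sums (Q : mx) (r : nat) : set R :=
  [set s | exists X Y : 'I_r -> mx, orth_planes Q X Y /\
                                   s = \sum_j kappa Q (X j) (Y j)].

Definition delta_up (Q : mx) (d : nat) (E : 'I_d -> mx) (r : nat) : R :=
  Scal Q E - inf (sect_sums Q r).
Definition delta_low (Q : mx) (d : nat) (E : 'I_d -> mx) (r : nat) : R :=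
  Scal Q E - sup (sect_sums Q r).

End Grassmannian.

(* Main.v *)
Require Import Defs.
From HB Require Import structures.
From mathcomp Require Import all_boot all_order all_algebra.
From mathcomp Require Import boolp functions classical_sets reals topology.
From mathcomp Require Import normedtype derive.
From mathcomp Require Import ring lra zify.
Import Order.TTheory GRing.Theory Num.Theory.
Local Open Scope ring_scope.

Set Implicit Arguments.
Unset Strict Implicit.
Unset Printing Implicit Defensive.

(** For tangent vectors at [Q] the curvature tensor of the embedded Grassmannian is
    [Rm(x, y, z, w) = <[[x, y], z], w> / 4], so an orthonormal pair has sectional
    curvature [|K|^2 / 4 >= 0] with [K = [x, y]]. The matrix [K] is antisymmetric and
    commutes with [Q]; since the singular values of each of its two diagonal blocks come
    in pairs, and [y] exchanges the eigenspaces of [Q], one gets [|K y| <= |K| |y| / 2],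
    and [|K|^2 = 2 <K y, x>] then yields [|K| <= |x| |y|], i.e. curvature at most [1/4].
    Both bounds are attained simultaneously by the required number of orthogonal planes,
    two for every 2 x 2 block of the off-diagonal part. The scalar curvature follows from
    [\sum_i E_i M E_i], which depends only on the projection onto the tangent space. *)

(** * Entrywise matrix identities and derivatives of matrix-valued curves *)

Lemma entryD {R : realType} {m n : nat} (A B : 'M[R]_(m, n)) i j :
  (A + B) i j = A i j + B i j.
Proof. by rewrite mxE. Qed.

Lemma entryN {R : realType} {m n : nat} (A : 'M[R]_(m, n)) i j :
  (- A) i j = - A i j.
Proof. by rewrite mxE. Qed.

Lemma entryZ {R : realType} {m n : nat} c (A : 'M[R]_(m, n)) i j :
  (c *: A) i j = c * A i j.
Proof. by rewrite mxE. Qed.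

Lemma entry0 {R : realType} {m n : nat} i j : (0 : 'M[R]_(m, n)) i j = 0.
Proof. by rewrite mxE. Qed.

(* Linear identities between matrices, products being treated as atoms. *)
Ltac mxlin :=
  let i := fresh "i" in let j := fresh "j" in
  apply/matrixP => i j; rewrite ?(entryD, entryN, entryZ, entry0); field.

Ltac mxexpand :=
  rewrite ?(mulmxDl, mulmxDr, mulmxBl, mulmxBr, mulmxN, mulNmx, mulmxA,
            =^~ scalemxAl, =^~ scalemxAr, mulmx1, mul1mx, scalerN, opprK).

(** Differentiates each entry as an [R^o]-valued function, exactly as [dirD] does, so the scalar
    rules of derivation transfer to matrix products. *)
Definition mxder {R : realType} {m n : nat}
    (F : R -> 'M[R]_(m, n)) (D : 'M[R]_(m, n)) : Prop :=
  forall i j, @is_derive R R^o R^o 0 1 (fun t => F t i j) (D i j).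

Lemma mxder_cst {R : realType} {m n : nat} (A : 'M[R]_(m, n)) :
  mxder (fun=> A) 0.
Proof. by move=> i j; rewrite mxE; exact: is_derive_cst. Qed.

Lemma mxderD {R : realType} {m n : nat} (F G : R -> 'M[R]_(m, n)) A B :
  mxder F A -> mxder G B -> mxder (fun t => F t + G t) (A + B).
Proof.
move=> dF dG i j; rewrite mxE.
have -> : (fun t => (F t + G t) i j : R^o)
    = (fun t => F t i j : R^o) + (fun t => G t i j : R^o).
  by apply/funext => t; rewrite mxE.
exact: is_deriveD.
Qed.

Lemma mxderZ {R : realType} {m n : nat} (c : R) (F : R -> 'M[R]_(m, n)) A :
  mxder F A -> mxder (fun t => c *: F t) (c *: A).
Proof.
move=> dF i j; rewrite mxE.
have -> : (fun t => (c *: F t) i j : R^o) = c \*: (fun t => F t i j : R^o).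
  by apply/funext => t; rewrite mxE.
exact: is_deriveZ.
Qed.

Lemma mxderB {R : realType} {m n : nat} (F G : R -> 'M[R]_(m, n)) A B :
  mxder F A -> mxder G B -> mxder (fun t => F t - G t) (A - B).
Proof.
move=> dF dG; rewrite -(scaleN1r B).
have -> : (fun t => F t - G t) = (fun t => F t + (-1) *: G t).
  by apply/funext => t; rewrite scaleN1r.
by apply: mxderD => //; apply: mxderZ.
Qed.

Lemma mxderM {R : realType} {m n p : nat}
    (F : R -> 'M[R]_(m, n)) (G : R -> 'M[R]_(n, p)) A B :
  mxder F A -> mxder G B ->
  mxder (fun t => F t *m G t) (A *m G 0 + F 0 *m B).
Proof.
move=> dF dG i j; rewrite !mxE -big_split /=.
have -> : (fun t => (F t *m G t) i j : R^o)
    = \sum_k ((fun t => F t i k : R^o) * (fun t => G t k j : R^o)).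
  by apply/funext => t; rewrite mxE fct_sumE.
apply: is_derive_sum => k.
apply: is_derive_eq; first exact: (is_deriveM (dF i k) (dG k j)).
by change (F 0 i k * B k j + G 0 k j * A i k
  = A i k * G 0 k j + F 0 i k * B k j); ring.
Qed.

Lemma mxder_line {R : realType} {m n : nat} (A B : 'M[R]_(m, n)) :
  mxder (fun t => A + t *: B) B.
Proof.
rewrite -[X in mxder _ X]add0r; apply: mxderD; first exact: mxder_cst.
move=> i j.
have -> : (fun t => (t *: B) i j : R^o) = B i j \*: (@id R^o).
  by apply/funext => t; rewrite mxE mulrC.
have := @is_deriveZ R R^o R^o id (B i j) 0 1 1 (is_derive_id _ _).
by rewrite /GRing.scale /= mulr1.
Qed.

Lemma dirD_mxder {R : realType} {n : nat} (f : 'M[R]_n -> 'M[R]_n) A B D :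
  mxder (fun t => f (A + t *: B)) D -> dirD f A B = D.
Proof.
move=> df; apply/matrixP => i j; rewrite mxE derive1E.
exact: (@derive_val _ _ _ _ _ _ _ (df i j)).
Qed.

(** * The connection on projected constant fields and the curvature tensor *)

Lemma symp_sym {R : realType} {n : nat} (Z : 'M[R]_n) : Z^T = Z -> symp Z = Z.
Proof. by move=> sZ; rewrite /symp sZ; mxlin. Qed.

Lemma mxder_ext {R : realType} {n : nat} (A B z : 'M[R]_n) : z^T = z ->
  mxder (fun t => ext z (A + t *: B)) (- 2^-1 *: (B *m z *m A + A *m z *m B)).
Proof.
move=> sz; rewrite /ext /tproj symp_sym //.
have dA := mxder_line A B.
have := mxderZ 2^-1 (mxderB (mxder_cst z)
  (mxderM (mxderM dA (mxder_cst z)) dA)).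
rewrite /= !scale0r !addr0 mulmx0 addr0.
by congr (mxder _ _); mxlin.
Qed.

Lemma dirD_ext {R : realType} {n : nat} (A B z : 'M[R]_n) : z^T = z ->
  dirD (ext z) A B = - 2^-1 *: (B *m z *m A + A *m z *m B).
Proof. by move=> sz; apply: dirD_mxder; exact: mxder_ext. Qed.

Lemma tprojE {R : realType} {n : nat} (A Z : 'M[R]_n) : Z^T = Z ->
  tproj A Z = 2^-1 *: (Z - A *m Z *m A).
Proof. by move=> sZ; rewrite /tproj symp_sym. Qed.

Lemma tproj_tangent {R : realType} {n : nat} (Q Z : 'M[R]_n) :
  Q *m Q = 1%:M -> tangent Q Z -> tproj Q Z = Z.
Proof.
move=> QQ [sZ /eqP]; rewrite addr_eq0 => /eqP QZ.
by rewrite tprojE // QZ mulNmx -mulmxA QQ mulmx1; mxlin.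
Qed.

Lemma ext_sym {R : realType} {n : nat} (A z : 'M[R]_n) :
  A^T = A -> z^T = z -> (ext z A)^T = ext z A.
Proof.
move=> sA sz; rewrite /ext tprojE //.
by rewrite linearZ linearB /= !trmx_mul sA sz mulmxA.
Qed.

(** Only the symmetry of A is assumed: [nabla2_ext] differentiates this formula along Q + t x, whose
    points are symmetric but in general not involutions. *)
Lemma nabla_ext {R : realType} {n : nat} (A y z : 'M[R]_n) :
  A^T = A -> y^T = y -> z^T = z ->
  let W := - 2^-1 *: (ext y A *m z *m A + A *m z *m ext y A) in
  nabla (ext y) (ext z) A = 2^-1 *: (W - A *m W *m A).
Proof.
move=> sA sy sz W; rewrite /nabla dirD_ext // tprojE //.
rewrite linearZ linearD /= !trmx_mul sA sz (ext_sym sA sy) !mulmxA.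
by rewrite [in RHS]addrC.
Qed.

Lemma tangent_anti {R : realType} {n : nat} (Q x : 'M[R]_n) : tangent Q x ->
  x *m Q = - (Q *m x).
Proof. by case=> _ /eqP; rewrite addrC addr_eq0 => /eqP. Qed.

Lemma nabla2_ext {R : realType} {n : nat} (Q x y z : 'M[R]_n) :
  Q^T = Q -> Q *m Q = 1%:M -> tangent Q x -> tangent Q y -> tangent Q z ->
  nabla (ext x) (nabla (ext y) (ext z)) Q =
  - 4^-1 *: (y *m x *m z + z *m x *m y + y *m z *m x + x *m z *m y).
Proof.
move=> sQ QQ tx ty tz.
have [[sx _] [sy _] [sz _]] := And3 tx ty tz.
have QQr (M : 'M[R]_n) : M *m Q *m Q = M by rewrite -mulmxA QQ mulmx1.
have [xQ yQ zQ] := And3 (tangent_anti tx) (tangent_anti ty) (tangent_anti tz).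
have aux (u : 'M_n) : u *m Q = - (Q *m u) ->
    forall M : 'M_n, M *m u *m Q = - (M *m Q *m u).
  by move=> uQ M; rewrite -mulmxA uQ mulmxN mulmxA.
have [xQr yQr zQr] := And3 (aux x xQ) (aux y yQ) (aux z zQ).
(* These rules move every Q to the left of x, y, z and cancel pairs of Q, which brings both sides to
   a common normal form. *)
have anti := (xQ, yQ, zQ, xQr, yQr, zQr, QQ, QQr).
set D := RHS.
have tD : tangent Q D.
  split.
    rewrite /D linearZ /= !linearD /= !trmx_mul sx sy sz !mulmxA.
    by mxlin.
  by rewrite /D; mxexpand; rewrite !(anti, mulmxN, mulNmx, opprK); mxlin.
(* The candidate D is tangent, so it may be put under [tproj Q]; it then suffices that the ambient
   derivative itself equals D. *)
rewrite -(tproj_tangent QQ tD); congr (tproj Q _).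
have -> : ext x Q = x by exact: tproj_tangent.
apply: dirD_mxder.
have sA t : (Q + t *: x)^T = Q + t *: x by rewrite linearD linearZ /= sQ sx.
rewrite (funext (fun t => nabla_ext (sA t) sy sz)).
have dA := mxder_line Q x; have dY := mxder_ext Q x sy.
have dW := mxderZ (- 2^-1) (mxderD
   (mxderM (mxderM dY (mxder_cst z)) dA)
   (mxderM (mxderM dA (mxder_cst z)) dY)).
have := mxderZ 2^-1 (mxderB dW (mxderM (mxderM dA dW) dA)).
rewrite /= !scale0r !addr0 !mulmx0 !addr0 (tproj_tangent QQ ty : ext y Q = y).
congr (mxder _ _); rewrite /D; mxexpand.
rewrite !(anti, mulmxN, mulNmx, opprK, scalerN, mul1mx).
by mxlin.
Qed.

(** In [nabla2_ext] the terms y z x + x z y are symmetric in x and y, so they cancel in the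
    difference; the other terms form a double commutator. *)
Lemma Rm_commutator {R : realType} {n : nat} (Q x y z w : 'M[R]_n) :
  Q^T = Q -> Q *m Q = 1%:M -> tangent Q x -> tangent Q y -> tangent Q z ->
  Rm Q x y z w =
  4^-1 * ip ((x *m y - y *m x) *m z - z *m (x *m y - y *m x)) w.
Proof.
move=> sQ QQ tx ty tz; rewrite /Rm.
rewrite !nabla2_ext //.
have [[sx _] [sy _] [sz _]] := And3 tx ty tz.
have [xQ yQ] := (tangent_anti tx, tangent_anti ty).
(* The products x y and y x commute with Q, so the bracket of the two extensions vanishes at Q, and
   [nabla] depends on its first field only through the value there. *)
have -> : nabla (lieb (ext x) (ext y)) (ext z) Q = 0.
  rewrite /nabla; have -> : lieb (ext x) (ext y) Q = 0.
    rewrite /lieb !dirD_ext //.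
    rewrite (tproj_tangent QQ tx : ext x Q = x) (tproj_tangent QQ ty : ext y Q = y).
    rewrite -!mulmxA xQ yQ !mulmxN !mulmxA xQ yQ !mulNmx !opprK.
    by mxlin.
  rewrite dirD_ext // mul0mx mulmx0 !mul0mx addr0 scaler0.
  by rewrite tprojE ?trmx0 // mulmx0 mul0mx subr0 scaler0.
rewrite subr0 /ip -mxtraceZ scalemxAl -linearZ /=.
by congr (\tr (_^T *m _)); mxexpand; mxlin.
Qed.

(** * The Frobenius inner product and norm bounds for antisymmetric matrices *)

(** Rectangular version of [ip], convertible to it on square matrices, so that column vectors are
    covered as well. *)
Definition frob {R : realType} {m n : nat} (A B : 'M[R]_(m, n)) : R :=
  \tr (A^T *m B).

Lemma frobE {R : realType} {m n : nat} (A B : 'M[R]_(m, n)) :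
  frob A B = \sum_j \sum_i A i j * B i j.
Proof.
rewrite /frob /mxtrace; apply: eq_bigr => j _; rewrite mxE.
by apply: eq_bigr => i _; rewrite mxE.
Qed.

Lemma frobC {R : realType} {m n : nat} (A B : 'M[R]_(m, n)) :
  frob A B = frob B A.
Proof. by rewrite /frob -mxtrace_tr trmx_mul trmxK. Qed.

Lemma frobDr {R : realType} {m n : nat} (A B C : 'M[R]_(m, n)) :
  frob A (B + C) = frob A B + frob A C.
Proof. by rewrite /frob mulmxDr mxtraceD. Qed.

Lemma frobZr {R : realType} {m n : nat} c (A B : 'M[R]_(m, n)) :
  frob A (c *: B) = c * frob A B.
Proof. by rewrite /frob -scalemxAr mxtraceZ. Qed.

Lemma frobDl {R : realType} {m n : nat} (A B C : 'M[R]_(m, n)) :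
  frob (A + B) C = frob A C + frob B C.
Proof. by rewrite frobC frobDr !(frobC C). Qed.

Lemma frobZl {R : realType} {m n : nat} c (A B : 'M[R]_(m, n)) :
  frob (c *: A) B = c * frob A B.
Proof. by rewrite frobC frobZr frobC. Qed.

Lemma frobNr {R : realType} {m n : nat} (A B : 'M[R]_(m, n)) :
  frob A (- B) = - frob A B.
Proof. by rewrite -scaleN1r frobZr mulN1r. Qed.

Lemma frobNl {R : realType} {m n : nat} (A B : 'M[R]_(m, n)) :
  frob (- A) B = - frob A B.
Proof. by rewrite frobC frobNr frobC. Qed.

Definition frob_linear := (@frobDl, @frobDr, @frobNl, @frobNr, @frobZl, @frobZr).

Lemma frob_ge0 {R : realType} {m n : nat} (A : 'M[R]_(m, n)) : 0 <= frob A A.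
Proof.
rewrite frobE; apply: sumr_ge0 => j _; apply: sumr_ge0 => i _.
by rewrite -expr2 sqr_ge0.
Qed.

Lemma frob_eq0 {R : realType} {m n : nat} (A : 'M[R]_(m, n)) :
  frob A A = 0 -> A = 0.
Proof.
rewrite frobE => A0; apply/matrixP => i j; rewrite mxE.
have sq_ge0 i' j' : 0 <= A i' j' * A i' j' by rewrite -expr2 sqr_ge0.
move: A0 => /psumr_eq0P A0.
have /psumr_eq0P B0 := A0 (fun j _ => sumr_ge0 _ (fun i _ => sq_ge0 i j)) j isT.
by have /eqP := B0 (fun i _ => sq_ge0 i j) i isT; rewrite mulf_eq0 orbb => /eqP.
Qed.

Lemma frob_CauchySchwarz {R : realType} {m n : nat} (A B : 'M[R]_(m, n)) :
  frob A B ^+ 2 <= frob A A * frob B B.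
Proof.
have := frob_ge0 B; rewrite le_eqVlt => /predU1P[/esym B0 | B_gt0].
  rewrite {1}(frob_eq0 B0) B0 mulr0.
  by rewrite /frob mulmx0 mxtrace0 expr0n.
have := frob_ge0 (frob B B *: A + - (frob A B *: B)).
rewrite !frob_linear (frobC B A).
set a := frob A A; set b := frob A B; set c := frob B B in B_gt0 *.
move=> h; have : 0 <= c * (a * c - b ^+ 2) by lra.
by rewrite pmulr_rge0 // subr_ge0.
Qed.

Lemma dot_scalar {R : realType} {n : nat} (v w : 'cV[R]_n) :
  v^T *m w = (frob v w)%:M.
Proof. by rewrite [LHS]mx11_scalar /frob /mxtrace big_ord1. Qed.

Lemma frob_outer {R : realType} {m n : nat}
    (v x : 'cV[R]_m) (w y : 'cV[R]_n) :
  frob (v *m w^T) (x *m y^T) = frob v x * frob w y.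
Proof.
rewrite {1}/frob trmx_mul trmxK mulmxA -(mulmxA w) dot_scalar.
rewrite -mulmxA mul_scalar_mx -scalemxAr mxtraceZ mxtrace_mulC.
by rewrite dot_scalar mxtrace_scalar mulr1n (frobC y).
Qed.

(* Testing K against w v^T - v w^T, w = K v, which has squared norm 2 |w|^2 |v|^2
   because w is orthogonal to v. *)
Lemma antisym_mulmx_vec {R : realType} {n : nat} (K : 'M[R]_n) (v : 'cV[R]_n) :
  K^T = - K -> 2 * frob (K *m v) (K *m v) <= frob K K * frob v v.
Proof.
move=> aK; set w := K *m v.
have wT : w^T = - (v^T *m K) by rewrite trmx_mul aK mulmxN.
have wv : frob w v = 0.
  have : frob w v = - frob w v.
    by rewrite {1}/frob wT mulNmx linearN /= -mulmxA -/w frobC.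
  lra.
have Kwv : frob K (w *m v^T) = frob w w.
  by rewrite /frob mulmxA mxtrace_mulC mulmxA wT aK mulmxN.
have Kvw : frob K (v *m w^T) = - frob w w.
  by rewrite /frob mulmxA aK !mulNmx linearN /= -/w mxtrace_mulC.
have := frob_CauchySchwarz K (w *m v^T - v *m w^T).
rewrite !frob_linear !frob_outer Kwv Kvw (frobC v w) wv.
have := frob_ge0 w; rewrite le_eqVlt => /predU1P[<- _|w_gt0].
  by rewrite mulr0 mulr_ge0 // frob_ge0.
set W := frob w w in w_gt0 *; set V := frob v v; set F := frob K K.
move=> h; have : 0 <= 2 * W * (F * V - 2 * W) by nra.
by rewrite pmulr_rge0 ?subr_ge0 // mulr_gt0.
Qed.

Lemma antisym_mulmx {R : realType} {n p : nat} (K : 'M[R]_n) (Y : 'M[R]_(n, p)) :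
  K^T = - K -> 2 * frob (K *m Y) (K *m Y) <= frob K K * frob Y Y.
Proof.
move=> aK.
have frob_col (Z : 'M[R]_(n, p)) : frob Z Z = \sum_j frob (col j Z) (col j Z).
  rewrite frobE; apply: eq_bigr => j _; rewrite frobE big_ord1.
  by apply: eq_bigr => i _; rewrite !mxE.
rewrite (frob_col (K *m Y)) (frob_col Y) !mulr_sumr.
apply: ler_sum => j _.
by rewrite [col j (K *m Y)]colE -mulmxA -colE; exact: antisym_mulmx_vec.
Qed.

(** Parallelogram law for Z and Q Z, which have equal norms because Q is orthogonal. *)
Lemma involution_pythagoras {R : realType} {n : nat} (Q Z : 'M[R]_n) :
  Q^T = Q -> Q *m Q = 1%:M ->
  frob (Z + Q *m Z) (Z + Q *m Z) + frob (Z - Q *m Z) (Z - Q *m Z) = 4 * frob Z Z.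
Proof.
move=> sQ QQ; rewrite !frob_linear (frobC (Q *m Z) Z).
have -> : frob (Q *m Z) (Q *m Z) = frob Z Z.
  by rewrite {1}/frob trmx_mul sQ mulmxA -(mulmxA _ Q Q) QQ mulmx1.
ring.
Qed.

(** Each eigenspace component of K y uses only one diagonal block of K and one off-diagonal half of
    y. That half carries half of |y|^2, which improves the constant 2 of [antisym_mulmx] to 4. *)
Lemma commuting_antisym_tangent {R : realType} {n : nat} (Q K y : 'M[R]_n) :
  Q^T = Q -> Q *m Q = 1%:M -> K^T = - K -> K *m Q = Q *m K -> tangent Q y ->
  4 * frob (K *m y) (K *m y) <= frob K K * frob y y.
Proof.
move=> sQ QQ aK KQ ty.
(* The bound for the component in the +1 eigenspace of P; it is used for P = Q and P = - Q, and the
   two are added by [involution_pythagoras]. *)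
suff half (P : 'M[R]_n) : P^T = P -> P *m P = 1%:M -> K *m P = P *m K ->
    tangent P y ->
    4 * frob (K *m y + P *m (K *m y)) (K *m y + P *m (K *m y)) <=
    frob (K + P *m K) (K + P *m K) * frob y y.
  have h1 := half Q sQ QQ KQ ty.
  have h2 : 4 * frob (K *m y - Q *m (K *m y)) (K *m y - Q *m (K *m y)) <=
    frob (K - Q *m K) (K - Q *m K) * frob y y.
    rewrite -!mulNmx; apply: half.
    - by rewrite linearN /= sQ.
    - by rewrite mulNmx mulmxN opprK.
    - by rewrite mulNmx mulmxN KQ.
    - by case: ty => sy Qy; split=> //; rewrite mulNmx mulmxN -opprD Qy oppr0.
  have := lerD h1 h2; rewrite -mulrDr -mulrDl !involution_pythagoras //.
  lra.
move=> sP PP KP [sy Py].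
have yP : y *m P = - (P *m y) by exact: (tangent_anti (conj sy Py)).
set K' := K + P *m K; set y' := y + P *m y.
have aK' : K'^T = - K'.
  by rewrite linearD /= trmx_mul sP aK mulNmx KP opprD.
have Ky' : K' *m y' = 2 *: (K *m y + P *m (K *m y)).
  rewrite /K' /y'; mxexpand; rewrite KP -(mulmxA P K P) KP !mulmxA PP mul1mx.
  by mxlin.
(* Since y anticommutes with P, the vectors y and P y are orthogonal, and they have equal norms. *)
have ny' : frob y' y' = 2 * frob y y.
  have Pyy : frob (P *m y) y = 0.
    have : frob (P *m y) y = - frob (P *m y) y.
      rewrite /frob trmx_mul sP sy {1}yP mulNmx linearN /=.
      by rewrite mxtrace_mulC mulmxA.
    lra.
  rewrite /y' !frob_linear (frobC y) Pyy.
  have -> : frob (P *m y) (P *m y) = frob y y.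
    by rewrite {1}/frob trmx_mul sP mulmxA -(mulmxA _ P P) PP mulmx1.
  ring.
have := antisym_mulmx y' aK'; rewrite Ky' ny' frobZl frobZr.
lra.
Qed.

(** Moving y across the inner product gives <K y, x> = <K, x y> and <y K, x> = <K, y x>.
    Transposition shows that these are opposite, and their difference is |K|^2. *)
Lemma commutator_frob {R : realType} {n : nat} (x y : 'M[R]_n) :
  x^T = x -> y^T = y -> let K := x *m y - y *m x in
  frob (K *m y) x = 2^-1 * frob K K /\ frob (y *m K) x = - (2^-1 * frob K K).
Proof.
move=> sx sy K.
have aK : K^T = - K by rewrite linearB /= !trmx_mul sx sy opprB.
have e1 : frob (K *m y) x = frob K (x *m y).
  by rewrite /frob trmx_mul sy -mulmxA mxtrace_mulC mulmxA.
have e2 : frob (y *m K) x = frob K (y *m x).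
  by rewrite /frob trmx_mul sy mulmxA.
have e3 : frob K (y *m x) = - frob K (x *m y).
  by rewrite /frob -mxtrace_tr !trmx_mul trmxK sx sy aK mulNmx
    mxtrace_mulC linearN /= opprK.
have e4 : frob K K = frob K (x *m y) - frob K (y *m x) by rewrite -frobNr -frobDr.
by rewrite e2 e4 e1 e3; split; field.
Qed.

(** * Bounds on the sectional curvature *)

Lemma kappa_commutator {R : realType} {n : nat} (Q x y : 'M[R]_n) :
  Q^T = Q -> Q *m Q = 1%:M -> tangent Q x -> tangent Q y ->
  kappa Q x y = 4^-1 * frob (x *m y - y *m x) (x *m y - y *m x).
Proof.
move=> sQ QQ tx ty; rewrite /kappa Rm_commutator //.
have [e1 e2] := commutator_frob tx.1 ty.1.
by rewrite -[ip _ _]/(frob _ _) frobDl frobNl e1 e2; field.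
Qed.

Lemma kappa_ge0 {R : realType} {n : nat} (Q x y : 'M[R]_n) :
  Q^T = Q -> Q *m Q = 1%:M -> tangent Q x -> tangent Q y -> 0 <= kappa Q x y.
Proof.
by move=> sQ QQ tx ty; rewrite kappa_commutator // mulr_ge0 ?invr_ge0 ?ler0n ?frob_ge0.
Qed.

Lemma kappa_le {R : realType} {n : nat} (Q x y : 'M[R]_n) :
  Q^T = Q -> Q *m Q = 1%:M -> tangent Q x -> tangent Q y ->
  kappa Q x y <= 4^-1 * (ip x x * ip y y).
Proof.
move=> sQ QQ tx ty; rewrite kappa_commutator // ler_pM2l ?invr_gt0 //.
have [e1 _] := commutator_frob tx.1 ty.1.
set K := x *m y - y *m x in e1 *.
have aK : K^T = - K by rewrite linearB /= !trmx_mul tx.1 ty.1 opprB.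
have KQ : K *m Q = Q *m K.
  rewrite mulmxBl mulmxBr -!mulmxA (tangent_anti tx) (tangent_anti ty) !mulmxN.
  by rewrite !mulmxA (tangent_anti tx) (tangent_anti ty) !mulNmx !opprK.
have h1 := commuting_antisym_tangent sQ QQ aK KQ ty.
have h2 := frob_CauchySchwarz (K *m y) x.
rewrite e1 in h2; rewrite -[ip x x]/(frob x x) -[ip y y]/(frob y y).
have := frob_ge0 x; have := frob_ge0 y; have := frob_ge0 K.
move: h1 h2; set k := frob K K; set X := frob x x; set Y := frob y y.
(* The two estimates chain to k^2 <= 4 N X <= k X Y; the case k = 0 is split off because k is then
   divided out. *)
set N := frob _ _ => h1 h2; rewrite le_eqVlt => /predU1P[<-|k_gt0] Y0 X0.
  by rewrite mulr_ge0.
have h3 : 0 <= X * (k * Y - 4 * N) by rewrite mulr_ge0 // subr_ge0.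
have : 0 <= k * (X * Y - k) by nra.
by rewrite pmulr_rge0 // subr_ge0.
Qed.

(** * The tangential projection, the Casimir element and the scalar curvature *)

Lemma tangent_tproj {R : realType} {n : nat} (Q Z : 'M[R]_n) :
  Q^T = Q -> Q *m Q = 1%:M -> tangent Q (tproj Q Z).
Proof.
move=> sQ QQ; have sS : (symp Z)^T = symp Z.
  by rewrite linearZ linearD /= trmxK addrC.
rewrite /tproj; split.
  by rewrite linearZ linearB /= !trmx_mul sS sQ mulmxA.
rewrite -scalemxAr -scalemxAl mulmxBr mulmxBl !mulmxA QQ mul1mx.
by rewrite -(mulmxA _ Q Q) QQ mulmx1; mxlin.
Qed.

(** A tangent X is symmetric and satisfies Q X Q = - X, so symmetrising Z changes nothing and the
    conjugated term contributes a second copy of <Z, X>. *)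
Lemma frob_tproj {R : realType} {n : nat} (Q X Z : 'M[R]_n) :
  Q^T = Q -> Q *m Q = 1%:M -> tangent Q X -> frob (tproj Q Z) X = frob Z X.
Proof.
move=> sQ QQ tX.
have sZ : frob (symp Z) X = frob Z X.
  rewrite frobZl frobDl.
  have -> : frob Z^T X = frob Z X.
    by rewrite /frob trmxK -mxtrace_tr trmx_mul tX.1 mxtrace_mulC.
  by field.
have QZ : frob (Q *m symp Z *m Q) X = - frob (symp Z) X.
  rewrite /frob !trmx_mul sQ -!mulmxA (mxtrace_mulC Q) -!mulmxA (tangent_anti tX).
  by rewrite !mulmxN (mulmxA Q Q) QQ mul1mx linearN.
by rewrite frobZl frobDl frobNl QZ sZ; field.
Qed.

Lemma tproj_onb {R : realType} {n d : nat} (Q Z : 'M[R]_n) (E : 'I_d -> 'M[R]_n) :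
  Q^T = Q -> Q *m Q = 1%:M -> is_onb Q E ->
  tproj Q Z = \sum_i frob Z (E i) *: E i.
Proof.
move=> sQ QQ [tE [_ spanE]]; rewrite [LHS]spanE; last exact: tangent_tproj.
by apply: eq_bigr => i _; rewrite -[ip _ _]/(frob _ _) frob_tproj.
Qed.

Lemma tproj_delta {R : realType} {n : nat} (Q : 'M[R]_n) p a b q : Q^T = Q ->
  tproj Q (delta_mx p a) b q =
  4^-1 * ((b == p)%:R * (q == a)%:R + (b == a)%:R * (q == p)%:R
          - (Q p b * Q a q + Q b a * Q p q)).
Proof.
move=> sQ; have QC i j : Q i j = Q j i by rewrite -{1}sQ mxE.
have QdQ i j : Q *m delta_mx i j *m Q = \matrix_(x, y) (Q x i * Q j y).
  apply/matrixP => x y; rewrite !mxE (bigD1 j) //= big1 ?addr0.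
    rewrite !mxE (bigD1 i) //= big1 ?addr0; first by rewrite mxE !eqxx mulr1.
    by move=> z zi; rewrite mxE (negPf zi) mulr0.
  move=> z zj; rewrite !mxE big1 ?mul0r // => w _.
  by rewrite mxE (negPf zj) andbF mulr0.
rewrite /tproj /symp trmx_delta -scalemxAr -scalemxAl mulmxDr mulmxDl !QdQ !mxE.
by rewrite (QC b p) -!mulnb !natrM; field.
Qed.

(* The Casimir element [\sum_i E_i (x) E_i] is the kernel of the orthogonal
   projection onto the tangent space, hence does not depend on the basis. *)
Lemma sum_onb_conj {R : realType} {n d : nat} (Q M : 'M[R]_n)
    (E : 'I_d -> 'M[R]_n) : Q^T = Q -> Q *m Q = 1%:M -> is_onb Q E ->
  \sum_i E i *m M *m E i =
  4^-1 *: (M^T + (\tr M)%:M - (Q *m M^T *m Q + \tr (M *m Q) *: Q)).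
Proof.
move=> sQ QQ onbE; apply/matrixP => p q.
(* The coefficient of the matrix unit [delta_mx p a] on E i is the entry (p, a) of E i, so
   [tproj_onb] evaluates the sum over the basis. *)
have kerE a b : \sum_i E i p a * E i b q = tproj Q (delta_mx p a) b q.
  rewrite (tproj_onb _ sQ QQ onbE) summxE; apply: eq_bigr => i _.
  rewrite mxE; congr (_ * _); rewrite frobE (bigD1 a) //= [X in _ + X]big1 ?addr0.
    rewrite (bigD1 p) //= big1 ?addr0; first by rewrite mxE !eqxx mul1r.
    by move=> z zp; rewrite mxE (negPf zp) mul0r.
  move=> z za; rewrite big1 // => w _.
  by rewrite mxE (negPf za) andbF mul0r.
have -> : (\sum_i E i *m M *m E i) p q =
    \sum_a \sum_b M a b * tproj Q (delta_mx p a) b q.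
  rewrite summxE.
  under eq_bigr => i _ do [rewrite -mulmxA mxE;
    under eq_bigr => a _ do rewrite mxE mulr_sumr].
  rewrite exchange_big /=; apply: eq_bigr => a _.
  rewrite exchange_big /=; apply: eq_bigr => b _.
  rewrite -kerE mulr_sumr; apply: eq_bigr => i _; ring.
have termE a b : M a b * tproj Q (delta_mx p a) b q = 4^-1 *
    (M a b * ((b == p)%:R * (q == a)%:R) + M a b * ((b == a)%:R * (q == p)%:R)
     - (M a b * (Q p b * Q a q) + M a b * (Q b a * Q p q))).
  by rewrite tproj_delta //; ring.
under eq_bigr => a _ do under eq_bigr => b _ do rewrite termE.
under eq_bigr => a _ do rewrite -mulr_sumr sumrB !big_split /=.
rewrite -mulr_sumr sumrB !big_split /= [RHS]entryZ; congr (_ * _).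
(* The four double sums are, in order, the (p, q) entries of the transpose of M, of tr(M) I, of Q
   M^T Q and of tr(M Q) Q. *)
rewrite !(entryD, entryN, entryZ); congr (_ + _ - (_ + _)).
- rewrite (bigD1 q) //= [X in _ + X]big1 ?addr0; last first.
    by move=> a aq; rewrite big1 // => b _; rewrite (eq_sym q) (negPf aq) !mulr0.
  rewrite (bigD1 p) //= big1 ?addr0; first by rewrite !eqxx !mulr1 mxE.
  by move=> b bp; rewrite (negPf bp) mul0r mulr0.
- rewrite mxE -[RHS]mulr_natr (eq_sym p) /mxtrace mulr_suml; apply: eq_bigr => a _.
  rewrite (bigD1 a) //= big1 ?addr0; first by rewrite eqxx mul1r.
  by move=> b ba; rewrite (negPf ba) mul0r mulr0.
- rewrite mxE; apply: eq_bigr => a _; rewrite mxE mulr_suml.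
  by apply: eq_bigr => b _; rewrite mxE; ring.
- rewrite /mxtrace mulr_suml; apply: eq_bigr => a _.
  by rewrite mxE mulr_suml; apply: eq_bigr => b _; ring.
Qed.

(** Summing the curvatures of all pairs of basis vectors gives (tr(C^2) - tr(C) / 2) / 2, where C is
    the sum of the squares E_i^2. By [sum_onb_conj], C is a combination of I and Q, and n^2 - (tr
    Q)^2 = 4 k (n - k) yields the closed form. *)
Lemma Scal_Grassmannian {R : realType} {n d k : nat} (Q : 'M[R]_n)
    (E : 'I_d -> 'M[R]_n) : inGr k Q -> is_onb Q E ->
  Scal Q E = (k%:R * (n%:R - k%:R) * (n%:R - 2)) / 8.
Proof.
move=> [sQ [QQ trQ]] onbE; have tE := onbE.1.
pose C : 'M[R]_n := \sum_i E i *m E i.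
have C_E : C = 4^-1 *: (n%:R%:M - \tr Q *: Q).
  have := sum_onb_conj 1%:M sQ QQ onbE.
  rewrite trmx1 mulmx1 QQ mul1mx mxtrace1.
  under eq_bigr => i _ do rewrite mulmx1.
  by rewrite -/C => ->; congr (_ *: _); mxlin.
(* Here M = E j: both traces vanish by anticommutation with Q, and conjugation by Q changes the sign
   of E j. *)
have EEE j : \sum_i E i *m E j *m E i = 2^-1 *: E j.
  have QE : Q *m E j *m Q = - E j.
    by rewrite -mulmxA (tangent_anti (tE j)) mulmxN mulmxA QQ mul1mx.
  have tr0 : \tr (E j) = 0.
    have : \tr (E j) = - \tr (E j).
      by rewrite -{1}(mul1mx (E j)) -QQ -mulmxA mxtrace_mulC QE linearN.
    lra.
  have trQ0 : \tr (E j *m Q) = 0.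
    have : \tr (E j *m Q) = - \tr (E j *m Q).
      by rewrite {1}(tangent_anti (tE j)) linearN /= mxtrace_mulC.
    lra.
  rewrite (sum_onb_conj _ sQ QQ onbE) (tE j).1 QE tr0 trQ0 raddf0 scale0r.
  by mxlin.
have kE i j : kappa Q (E i) (E j) = 2^-1 *
    (\tr (E i *m E i *m (E j *m E j)) - \tr (E j *m E i *m E j *m E i)).
  rewrite kappa_commutator //.
  have [e1 _] := commutator_frob (tE i).1 (tE j).1.
  set K := _ - _ in e1 *.
  have -> : frob K K = 2 * frob (K *m E j) (E i) by rewrite e1; field.
  rewrite /frob trmx_mul (tE j).1 linearB /= !trmx_mul (tE i).1 (tE j).1.
  rewrite mulmxBr mulmxBl linearB /= !mulmxA.
  have -> : \tr (E j *m E j *m E i *m E i) = \tr (E i *m E i *m E j *m E j).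
    by rewrite -mulmxA mxtrace_mulC !mulmxA.
  by field.
have -> : Scal Q E = 2^-1 * (\tr (C *m C) - 2^-1 * \tr C).
  rewrite /Scal /Ric.
  under eq_bigr => i _ do under eq_bigr => j _ do
    rewrite -[Rm _ _ _ _ _]/(kappa Q (E i) (E j)) kE.
  under eq_bigr => i _ do rewrite -mulr_sumr sumrB.
  rewrite -mulr_sumr sumrB; congr (_ * (_ - _)).
    rewrite {1}/C mulmx_suml raddf_sum /=; apply: eq_bigr => i _.
    by rewrite /C mulmx_sumr raddf_sum.
  rewrite [in RHS]/C raddf_sum mulr_sumr; apply: eq_bigr => i _.
  by rewrite -mxtraceZ scalemxAl -EEE mulmx_suml raddf_sum.
have trC : \tr C = 4^-1 * (n%:R * n%:R - \tr Q * \tr Q).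
  rewrite C_E mxtraceZ; congr (_ * _); rewrite linearB /= mxtraceZ mxtrace_scalar.
  by rewrite mulr_natr.
have trCC : \tr (C *m C) =
    16^-1 * (n%:R * (n%:R * n%:R - \tr Q * \tr Q)).
  have -> : C *m C = 16^-1 *:
      ((n%:R * n%:R + \tr Q * \tr Q) *: 1%:M - (2 * n%:R * \tr Q) *: Q).
    by rewrite C_E -scalemx1; mxexpand; rewrite QQ; mxlin.
  rewrite mxtraceZ linearB /= !mxtraceZ mxtrace1.
  by field.
by rewrite trC trCC trQ natrM; field.
Qed.

(** * Orthonormal frames of the eigenspaces *)

(** Induction on the trace: a normalised nonzero column e of P lies in its range, and P - e e^T is a
    projector with trace one less. *)
Lemma projector_frame {R : realType} {n : nat} (k : nat) (P : 'M[R]_n) :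
  P^T = P -> P *m P = P -> \tr P = k%:R ->
  exists u : nat -> 'cV[R]_n, (forall i, (i < k)%N -> P *m u i = u i) /\
    (forall i j, (i < k)%N -> (j < k)%N -> frob (u i) (u j) = (i == j)%:R).
Proof.
elim: k P => [|k IHk] P sP PP trP; first by exists (fun=> 0).
have [j colj_neq0] : exists j, col j P != 0.
  apply: contrapT => col0; suff P0 : P = 0.
    by move: trP => /eqP; rewrite P0 mxtrace0 eq_sym pnatr_eq0.
  apply/matrixP => i j; have [/eqP colj0|] := boolP (col j P == 0).
    by move/matrixP/(_ i 0): colj0; rewrite !mxE.
  by move=> ?; exfalso; apply: col0; exists j.
set w := col j P in colj_neq0.
have Pw : P *m w = w by rewrite /w colE mulmxA PP.
have w_gt0 : 0 < frob w w.
  rewrite lt_neqAle frob_ge0 andbT eq_sym; apply: contra_neq colj_neq0.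
  exact: frob_eq0.
pose e := (Num.sqrt (frob w w))^-1 *: w.
have ee : frob e e = 1.
  rewrite frobZl frobZr mulrA -invfM -expr2 sqr_sqrtr ?ltW //.
  by rewrite mulVf // gt_eqF.
have Pe : P *m e = e by rewrite -scalemxAr Pw.
have eP : e^T *m P = e^T by rewrite -{1}sP -trmx_mul Pe.
pose P' := P - e *m e^T.
have P'e : P' *m e = 0.
  by rewrite mulmxBl Pe -mulmxA dot_scalar ee mulmx1 subrr.
have sP' : P'^T = P' by rewrite linearB /= trmx_mul trmxK sP.
have P'P : P' *m P = P' by rewrite mulmxBl PP -mulmxA eP.
have [||u [Pu uu]] := IHk P' sP'.
- by rewrite {2}/P' mulmxBr P'P mulmxA P'e mul0mx subr0.
- rewrite linearB /= trP mxtrace_mulC dot_scalar ee mxtrace1.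
  by rewrite -addn1 natrD addrK.
have PP' : P *m P' = P' by rewrite -sP' -{1}sP -trmx_mul P'P.
have eu i : (i < k)%N -> frob e (u i) = 0.
  by move=> ik; rewrite -Pu // /frob mulmxA -sP' -trmx_mul P'e trmx0 mul0mx mxtrace0.
(* The new vector takes index k; the earlier ones are orthogonal to it because they lie in the range
   of P'. *)
exists (fun i => if (i < k)%N then u i else e); split.
  by move=> i _; case: ifPn => // ik; rewrite -{1}Pu // mulmxA PP' Pu.
move=> i i'; rewrite !ltnS => le_ik le_i'k.
case: ifPn => [ik|]; case: ifPn => [i'k|].
- exact: uu.
- rewrite -leqNgt => ki'; rewrite frobC eu //.
  by rewrite (_ : (i == i') = false) //; apply/eqP; lia.
- rewrite -leqNgt => ki; rewrite eu //.
  by rewrite (_ : (i == i') = false) //; apply/eqP; lia.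
- rewrite -!leqNgt => ki' ki; rewrite ee (_ : (i == i') = true) //.
  by apply/eqP; lia.
Qed.

(** Apply [projector_frame] to (I + Q)/2 and (I - Q)/2, whose traces are k and n - k; eigenvectors
    for opposite eigenvalues of the symmetric Q are orthogonal. *)
Lemma eigenframe {R : realType} {n k : nat} (Q : 'M[R]_n) :
  (k <= n)%N -> inGr k Q ->
  exists u v : nat -> 'cV[R]_n,
  [/\ forall i, (i < k)%N -> Q *m u i = u i,
      forall i, (i < n - k)%N -> Q *m v i = - v i,
      forall i j, (i < k)%N -> (j < k)%N -> frob (u i) (u j) = (i == j)%:R,
      forall i j, (i < n - k)%N -> (j < n - k)%N ->
        frob (v i) (v j) = (i == j)%:R &
      forall i j, (i < k)%N -> (j < n - k)%N -> frob (u i) (v j) = 0].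
Proof.
move=> le_kn [sQ [QQ trQ]].
have [|||u [Pu uu]] := @projector_frame R n k (2^-1 *: (1%:M + Q)).
- by rewrite linearZ linearD /= trmx1 sQ.
- by mxexpand; rewrite QQ; mxlin.
- by rewrite mxtraceZ linearD /= mxtrace1 trQ natrM; field.
have [|||v [Pv vv]] := @projector_frame R n (n - k) (2^-1 *: (1%:M - Q)).
- by rewrite linearZ linearB /= trmx1 sQ.
- by mxexpand; rewrite QQ; mxlin.
- by rewrite mxtraceZ linearB /= mxtrace1 trQ natrM natrB //; field.
have Qu i : (i < k)%N -> Q *m u i = u i.
  move=> /Pu; mxexpand => h; rewrite -[RHS]h -{1}h; mxexpand.
  by rewrite QQ mul1mx; mxlin.
have Qv i : (i < n - k)%N -> Q *m v i = - v i.
  move=> /Pv; mxexpand => h; rewrite -[in RHS]h -{1}h; mxexpand.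
  by rewrite QQ mul1mx; mxlin.
exists u, v; split=> // i j ik jk.
have : frob (u i) (v j) = - frob (u i) (v j).
  by rewrite -{1}(Qu i ik) /frob trmx_mul sQ -mulmxA Qv // mulmxN linearN.
lra.
Qed.

(** * Explicit orthogonal planes of curvature 0 and 1/4 *)

Definition symouter {R : realType} {n : nat} (x y : 'cV[R]_n) : 'M[R]_n :=
  x *m y^T + y *m x^T.

Lemma symouter_sym {R : realType} {n : nat} (x y : 'cV[R]_n) :
  (symouter x y)^T = symouter x y.
Proof. by rewrite linearD /= !trmx_mul !trmxK addrC. Qed.

Lemma tangent_symouter {R : realType} {n : nat} (Q : 'M[R]_n) x y :
  Q^T = Q -> Q *m x = x -> Q *m y = - y -> tangent Q (symouter x y).
Proof.
move=> sQ Qx Qy; split; first exact: symouter_sym.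
have xQ : x^T *m Q = x^T by rewrite -{1}sQ -trmx_mul Qx.
have yQ : y^T *m Q = - y^T by rewrite -{1}sQ -trmx_mul Qy linearN.
rewrite mulmxDr mulmxDl !mulmxA Qx Qy -!mulmxA xQ yQ mulmxN mulNmx.
by mxlin.
Qed.

Lemma tangentD {R : realType} {n : nat} (Q x y : 'M[R]_n) :
  tangent Q x -> tangent Q y -> tangent Q (x + y).
Proof.
move=> [sx Qx] [sy Qy]; split; first by rewrite linearD /= sx sy.
by rewrite mulmxDr mulmxDl addrACA Qx Qy addr0.
Qed.

Lemma tangentZ {R : realType} {n : nat} c (Q x : 'M[R]_n) :
  tangent Q x -> tangent Q (c *: x).
Proof.
move=> [sx Qx]; split; first by rewrite linearZ /= sx.
by rewrite -scalemxAr -scalemxAl -scalerDr Qx scaler0.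
Qed.

Lemma outer_mul {R : realType} {n : nat} (x y z w : 'cV[R]_n) :
  (x *m y^T) *m (z *m w^T) = frob y z *: (x *m w^T).
Proof. by rewrite mulmxA -(mulmxA x) dot_scalar mul_mx_scalar -scalemxAl. Qed.

(** The hypotheses hold when x, z lie in one eigenspace of Q and y, w in the other; they remove two
    of the four terms. *)
Lemma symouter_mul {R : realType} {n : nat} (x y z w : 'cV[R]_n) :
  frob x w = 0 -> frob y z = 0 ->
  symouter x y *m symouter z w =
  frob y w *: (x *m z^T) + frob x z *: (y *m w^T).
Proof.
move=> xw yz; rewrite /symouter mulmxDl !mulmxDr !outer_mul xw yz.
by mxlin.
Qed.

Lemma frob_symouter {R : realType} {n : nat} (x y z w : 'cV[R]_n) :
  frob x w = 0 -> frob y z = 0 ->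
  frob (symouter x y) (symouter z w) = 2 * (frob x z * frob y w).
Proof.
move=> xw yz; rewrite /symouter !frob_linear !frob_outer xw yz.
by ring.
Qed.

(** The product x y is an antisymmetric W, hence y x = - W and the commutator is 2 W, of squared
    norm 1. The sign e covers both curved planes of a block. *)
Lemma kappa_quarter {R : realType} {n : nat} (Q : 'M[R]_n) (e : R)
    (u0 u1 v0 v1 : 'cV[R]_n) :
  let x := 2^-1 *: (symouter u0 v0 + e *: symouter u1 v1) in
  let y := 2^-1 *: (symouter u0 v1 + - e *: symouter u1 v0) in
  Q^T = Q -> Q *m Q = 1%:M -> tangent Q x -> tangent Q y -> e * e = 1 ->
  frob u0 u0 = 1 -> frob u1 u1 = 1 -> frob u0 u1 = 0 ->
  frob v0 v0 = 1 -> frob v1 v1 = 1 -> frob v0 v1 = 0 ->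
  frob u0 v0 = 0 -> frob u0 v1 = 0 -> frob u1 v0 = 0 -> frob u1 v1 = 0 ->
  kappa Q x y = 4^-1.
Proof.
move=> x y sQ QQ tx ty ee u00 u11 u01 v00 v11 v01 uv00 uv01 uv10 uv11.
have [u10 v10] : frob u1 u0 = 0 /\ frob v1 v0 = 0 by rewrite frobC u01 frobC v01.
have [[vu00 vu01] [vu10 vu11]] :
  (frob v0 u0 = 0 /\ frob v0 u1 = 0) /\ (frob v1 u0 = 0 /\ frob v1 u1 = 0).
  by rewrite 4!(frobC _ u0, frobC _ u1) uv00 uv01 uv10 uv11.
have dots := (u00, u11, u01, u10, v00, v11, v01, v10,
  uv00, uv01, uv10, uv11, vu00, vu01, vu10, vu11).
pose W := 4^-1 *: (v0 *m v1^T - v1 *m v0^T + e *: (u1 *m u0^T - u0 *m u1^T)).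
have xy : x *m y = W.
  have expand (A B C D : 'M[R]_n) :
      (2^-1 *: (A + e *: B)) *m (2^-1 *: (C + - e *: D)) =
      4^-1 *: (A *m C - e *: (A *m D) + e *: (B *m C) - (e * e) *: (B *m D)).
    by mxexpand; mxlin.
  rewrite /x /y expand !symouter_mul ?dots // ee /W.
  by mxlin.
have yx : y *m x = - W.
  rewrite -ty.1 -tx.1 -trmx_mul xy /W linearZ /=.
  have tr_lin (A B C D : 'M[R]_n) :
      (A - B + e *: (C - D))^T = A^T - B^T + e *: (C^T - D^T).
    by apply/matrixP => i j; rewrite !mxE.
  by rewrite tr_lin !trmx_mul !trmxK; mxlin.
rewrite kappa_commutator // xy yx /W !frob_linear !frob_outer !dots.
by field: ee.
Qed.

Lemma kappa_commuting {R : realType} {n : nat} (Q x y : 'M[R]_n) :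
  Q^T = Q -> Q *m Q = 1%:M -> tangent Q x -> tangent Q y ->
  x *m y = y *m x -> kappa Q x y = 0.
Proof.
move=> sQ QQ tx ty xy; rewrite kappa_commutator // xy subrr.
by rewrite /frob mulmx0 mxtrace0 mulr0.
Qed.

(** Two bits encode the four vectors of block (a, b): [p] selects the diagonal or the antidiagonal
    pairs and [e] the sign, so orthogonality reduces to comparing bits and block indices. *)
Definition block_vector {R : realType} {n : nat} (u v : nat -> 'cV[R]_n)
    (e p : bool) (a b : nat) : 'M[R]_n :=
  2^-1 *: (symouter (u (2 * a)%N) (v (2 * b + p)%N)
           + (-1) ^+ e *: symouter (u (2 * a + 1)%N) (v (2 * b + ~~ p)%N)).

(* Each 2 x 2 block of pairs (u_i, v_j) carries four orthonormal tangent vectors,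
   A, B = (T00 +- T11)/2 and C, D = (T01 +- T10)/2. The planes (A, D), (B, C)
   have curvature 1/4, the planes (A, B), (C, D) are flat. *)
Lemma extremal_planes {R : realType} {n k r : nat} (Q : 'M[R]_n) :
  (k <= n)%N -> (r <= 2 * (k %/ 2) * ((n - k) %/ 2))%N -> inGr k Q ->
  (exists X Y : 'I_r -> 'M[R]_n,
     orth_planes Q X Y /\ forall j, kappa Q (X j) (Y j) = 0) /\
  (exists X Y : 'I_r -> 'M[R]_n,
     orth_planes Q X Y /\ forall j, kappa Q (X j) (Y j) = 4^-1).
Proof.
move=> le_kn le_r GrQ; have [sQ [QQ _]] := GrQ.
have [u [v [Qu Qv uu vv uv]]] := eigenframe le_kn GrQ.
have vu i j : (i < n - k)%N -> (j < k)%N -> frob (v i) (u j) = 0.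
  by move=> ik jk; rewrite frobC uv.
set M := ((n - k) %/ 2)%N in le_r.
(* The index j encodes a block by j / 2 = a M + b, and its parity chooses one of the two planes in
   that block. *)
pose a (j : 'I_r) := ((j %/ 2) %/ M)%N; pose b (j : 'I_r) := ((j %/ 2) %% M)%N.
(* M may vanish when r = 0, so positivity is stated given an index j. *)
have M_gt0 (j : 'I_r) : (0 < M)%N.
  by have := ltn_ord j; case: (M) le_r => [|//]; rewrite muln0; lia.
have a_lt j : (2 * a j + 1 < k)%N.
  have : (a j < k %/ 2)%N by rewrite ltn_divLR ?(M_gt0 j) //; have := ltn_ord j; lia.
  lia.
have b_lt j : (2 * b j + 1 < n - k)%N.
  have : (b j < M)%N by rewrite ltn_mod (M_gt0 j).
  rewrite /M; lia.
have b_lt' j (p : bool) : (2 * b j + p < n - k)%N by have := b_lt j; case: p; lia.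
have a_lt' j : (2 * a j < k)%N by have := a_lt j; lia.
have ab_inj (i j : 'I_r) :
    (odd i == odd j) && ((a i == a j) && (b i == b j)) = (i == j).
  apply/idP/eqP => [/andP[/eqP odd_ij /andP[/eqP a_ij /eqP b_ij]]|->]; last first.
    by rewrite !eqxx.
  apply: val_inj => /=; rewrite (divn_eq i 2) (divn_eq j 2) !modn2 odd_ij.
  by rewrite (divn_eq (i %/ 2) M) (divn_eq (j %/ 2) M) -/(a i) -/(b i) a_ij b_ij.
pose F e p j := block_vector u v e p (a j) (b j).
have tF e p j : tangent Q (F e p j).
  apply/tangentZ/tangentD; last apply: tangentZ; apply: tangent_symouter => //;
    by [exact: Qu | exact: Qv].
have FF e p i e' p' j : ip (F e p i) (F e' p' j) =
    ((e == e') && (p == p') && ((a i == a j) && (b i == b j)))%:R.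
  rewrite -[ip _ _]/(frob _ _) /F /block_vector.
  have expand c c' (A B C D : 'M[R]_n) :
      frob (2^-1 *: (A + c *: B)) (2^-1 *: (C + c' *: D)) =
      4^-1 * (frob A C + c' * frob A D + c * frob B C + c * c' * frob B D).
    by rewrite !frob_linear; field.
  rewrite expand !frob_symouter ?uu ?vv ?uv ?vu //.
  have -> : (2 * a i == 2 * a j + 1)%N = false by apply/eqP; lia.
  have -> : (2 * a i + 1 == 2 * a j)%N = false by apply/eqP; lia.
  have -> : (2 * a i == 2 * a j)%N = (a i == a j) by apply/eqP/eqP; lia.
  have -> : (2 * a i + 1 == 2 * a j + 1)%N = (a i == a j) by apply/eqP/eqP; lia.
  have bE (q q' : bool) : (2 * b i + q == 2 * b j + q')%N = (q == q') && (b i == b j).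
    by apply/eqP/andP => [|[/eqP-> /eqP->] //]; case: q; case: q' => /= h; split;
      apply/eqP; lia.
  rewrite !bE; case: (a i == a j); case: (b i == b j); case: e; case: e';
    case: p; case: p'; rewrite /= ?expr0 ?expr1; by field.
have nz (p : bool) j : (2 * b j + p == 2 * b j + ~~ p)%N = false.
  by apply/eqP; case: p => /=; lia.
split.
  (* Flat planes: parity is the bit [p], giving (A, B) for even j and (C, D) for odd j. *)
  exists (fun j : 'I_r => F false (odd j) j),
    (fun j : 'I_r => F true (odd j) j).
  split; [split; [|split; [|split]]|].
  - by move=> j.
  - by move=> i j; rewrite FF -ab_inj.
  - by move=> i j; rewrite FF -ab_inj.
  - by move=> i j; rewrite FF.
  move=> j; apply: kappa_commuting => //; rewrite /F /block_vector.
  set T0 := symouter _ _; set T1 := symouter _ _.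
  (* The two summands involve disjoint frame vectors, so their products vanish and the sum commutes
     with the difference. *)
  have T01 : T0 *m T1 = 0.
    rewrite symouter_mul ?uv ?vu // uu // vv // nz.
    by rewrite (_ : (_ == _)%N = false) ?scale0r ?addr0 //; apply/eqP; lia.
  have T10 : T1 *m T0 = 0.
    by rewrite -[T1]symouter_sym -[T0]symouter_sym -trmx_mul T01 trmx0.
  have expand c (A B : 'M[R]_n) : A *m B = 0 -> B *m A = 0 ->
      (2^-1 *: (A + c *: B)) *m (2^-1 *: (A + - c *: B)) =
      (2^-1 *: (A + - c *: B)) *m (2^-1 *: (A + c *: B)).
    by move=> AB BA; mxexpand; rewrite AB BA; mxlin.
  have := expand 1 _ _ T01 T10; by rewrite /= expr0 expr1.
(* Curved planes: parity is now the sign bit, giving (A, D) for even j and (B, C) for odd j. *)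
exists (fun j : 'I_r => F (odd j) false j),
    (fun j : 'I_r => F (~~ odd j) true j).
split; [split; [|split; [|split]]|].
- by move=> j.
- by move=> i j; rewrite FF -ab_inj andbT.
- by move=> i j; rewrite FF -ab_inj (inj_eq negb_inj) andbT.
- by move=> i j; rewrite FF andbF.
move=> j; have tx := tF (odd j) false j; have ty := tF (~~ odd j) true j.
have a01 : (2 * a j == 2 * a j + 1)%N = false by apply/eqP; lia.
have b01 : (2 * b j + 0 == 2 * b j + 1)%N = false by apply/eqP; lia.
have b0_lt : (2 * b j + 0 < n - k)%N by exact: (b_lt' j false).
move: tx ty; rewrite /F /block_vector /=.
have -> : (-1) ^+ (~~ odd j) = - (-1) ^+ (odd j) :> R.
  by case: (odd j); rewrite /= ?expr0 ?expr1 ?opprK.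
move=> tx ty; apply: kappa_quarter => //; rewrite ?uu ?vv ?uv ?eqxx //.
- by case: (odd j); rewrite /= ?expr0 ?expr1; ring.
- by rewrite a01.
- by rewrite b01.
Qed.

(** * The extremal curvature sums and the two invariants *)

Theorem mainTheorem10 (R : realType) (n k r : nat) (Q : 'M[R]_n) :
  (1 <= k)%N -> (k <= n - 1)%N ->
  (0 < r)%N -> (r <= 2 * (k %/ 2) * ((n - k) %/ 2))%N ->
  inGr k Q ->
  forall (d : nat) (E : 'I_d -> 'M[R]_n), is_onb Q E ->
    delta_up Q E r = (k * (n - k) * (n - 2))%:R / 8 /\
    delta_low Q E r = (k * (n - k) * (n - 2))%:R / 8 - r%:R / 4.
Proof.
move=> k_gt0 k_lt _ le_r GrQ d E onbE; have [sQ [QQ _]] := GrQ.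
have le_kn : (k <= n)%N by lia.
have [[X0 [Y0 [pl0 k0]]] [X1 [Y1 [pl1 k1]]]] := extremal_planes le_kn le_r GrQ.
have in0 : sect_sums Q r 0 by exists X0, Y0; split=> //; rewrite big1.
have in1 : sect_sums Q r (r%:R / 4).
  exists X1, Y1; split=> //; under eq_bigr do rewrite k1.
  by rewrite sumr_const card_ord mulr_natl.
have lb : lbound (sect_sums Q r) 0.
  move=> _ [X [Y [[tXY _] ->]]]; apply: sumr_ge0 => j _.
  by have [tX tY] := tXY j; exact: kappa_ge0.
have ub : ubound (sect_sums Q r) (r%:R / 4).
  move=> _ [X [Y [[tXY [XX [YY _]]] ->]]].
  have -> : r%:R / 4 = \sum_(j < r) (4^-1 : R).
    by rewrite sumr_const card_ord mulr_natl.
  apply: ler_sum => j _; have [tX tY] := tXY j.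
  by have := kappa_le sQ QQ tX tY; rewrite XX YY eqxx !mulr1.
(* The values 0 and r/4 belong to the set and bound it, so the infimum and supremum are attained. *)
have inf0 : inf (sect_sums Q r) = 0.
  apply/le_anti; rewrite lb_le_inf ?ge_inf //; last by exists 0.
  by exists 0.
have sup1 : sup (sect_sums Q r) = r%:R / 4.
  apply/le_anti; rewrite ge_sup ?ub_le_sup //; last by exists (r%:R / 4).
  by exists (r%:R / 4).
rewrite /delta_up /delta_low inf0 sup1 (Scal_Grassmannian GrQ onbE) subr0.
(* The natural subtractions do not truncate: 1 <= k <= n - 1 forces k <= n and 2 <= n. *)
by rewrite !natrM !natrB //; lia.
Qed.
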